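(* Let $G$ be a locally compact group, $\phi$ a topological automorphism of $G$, and $U$ a compact open subgroup of $G$ that is topologically quasinormal in $G$. Then $$H_{alg}(\phi^{-1},U)=H_{alg}(\phi,U)-\log\Delta(\phi).$$ In particular, if $G$ is a compactly covered locally compact topologically quasihamiltonian group and $\phi$ is a topological automorphism of $G$, then $$h_{alg}(\phi^{-1})=h_{alg}(\phi)-\log\Delta(\phi).$$
   Context: All topological groups are Hausdorff. A topological group is compactly covered if each of its elements lies in a compact subgroup. A closed subgroup $N$ of a topological group $G$ is topologically quasinormal if $\overline{NL}=\overline{LN}$ for every closed subgroup $L$ of $G$; $G$ is topologically quasihamiltonian if every closed subgroup of $G$ is topologically quasinormal. A topological automorphism is a group automorphism that is also a homeomorphism. Modulus: if $\lambda$ is a left Haar measure on $G$, then for a topological automorphism $\phi$ of $G$ the modulus $\Delta(\phi)>0$ is the real number such that $\lambda(\phi(E))=\Delta(\phi)\lambda(E)$ for every measurable $E\subseteq G$. Algebraic entropy: let $\mu$ be a right Haar measure on $G$ and $\phi$ a continuous endomorphism of $G$. For $U\subseteq G$ and $n\geq 1$ put $T_n(\phi,U)=U\cdot\phi(U)\cdots\phi^{n-1}(U)$. For $U$ a compact neighborhood of $e_G$ put $H_{alg}(\phi,U)=\limsup_{n\to\infty}\frac{\log\mu(T_n(\phi,U))}{n}$, and let $h_{alg}(\phi)\in[0,\infty]$ be the supremum of $H_{alg}(\phi,U)$ over all compact neighborhoods $U$ of $e_G$. *)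

(* Defs.v *)
From HB Require Import structures.
From mathcomp Require Import all_boot all_order all_algebra.
From mathcomp Require Import all_classical all_reals all_analysis.

Set Implicit Arguments.
Unset Strict Implicit.
Unset Printing Implicit Defensive.

Local Open Scope classical_set_scope.
Local Open Scope group_scope.

(* The base point plays no role; it is in the structure only because the
   library's measurable types must be pointed. *)
HB.structure Definition PreTopologicalGroup :=
  {G of Group G & PointedTopological G}.

HB.mixin Record PreTopologicalGroup_isTopologicalGroup G
    & PreTopologicalGroup G := {
  mulg_continuous : continuous (fun x : G * G => x.1 * x.2) ;
  invg_continuous : continuous (fun x : G => x^-1)
}.

#[short(type="topologicalGroupType")]
HB.structure Definition TopologicalGroup :=
  {G of PreTopologicalGroup G & PreTopologicalGroup_isTopologicalGroup G}.

Notation borel G := (g_sigma_algebraType (@open G)).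

Section Subgroups.
Variable G : topologicalGroupType.
Implicit Types A B H K L N : set G.

Definition mulset A B : set G := [set x * y | x in A & y in B].

Definition subgroup H : Prop :=
  [/\ H 1, forall x y, H x -> H y -> H (x * y) & forall x, H x -> H x^-1].

Definition closed_subgroup H : Prop := subgroup H /\ closed H.

(* Only meant for closed subgroups N. *)
Definition topologically_quasinormal N : Prop :=
  forall L, closed_subgroup L -> closure (mulset N L) = closure (mulset L N).

End Subgroups.

Definition topologically_quasihamiltonian (G : topologicalGroupType) : Prop :=
  forall N : set G, closed_subgroup N -> topologically_quasinormal N.

Definition compactly_covered (G : topologicalGroupType) : Prop :=
  forall x : G, exists K : set G, [/\ subgroup K, compact K & K x].

Record topAut (G : topologicalGroupType) := TopAut {
  topaut_fun :> G -> G ;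
  topaut_invfun : G -> G ;
  topautM : {morph topaut_fun : x y / x * y} ;
  topautK : cancel topaut_fun topaut_invfun ;
  topautVK : cancel topaut_invfun topaut_fun ;
  topaut_continuous : continuous topaut_fun ;
  topautV_continuous : continuous topaut_invfun
}.

Lemma topautVM (G : topologicalGroupType) (phi : topAut G) :
  {morph topaut_invfun phi : x y / x * y}.
Proof.
move=> x y; apply: (can_inj (topautK phi)).
by rewrite topautM !topautVK.
Qed.

Definition topaut_inv (G : topologicalGroupType) (phi : topAut G) : topAut G :=
  TopAut (@topautVM G phi) (topautVK phi) (topautK phi)
    (topautV_continuous (t := phi)) (topaut_continuous (t := phi)).

Section Haar.
Local Open Scope ring_scope.
Variables (R : realType) (G : topologicalGroupType).
Implicit Types mu lambda : {measure set (borel G) -> \bar R}.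
Local Open Scope ereal_scope.

Definition radon mu : Prop :=
  [/\ forall K : set G, compact K -> mu K < +oo,
      forall E : set (borel G), measurable E ->
        mu E = ereal_inf [set mu O | O in [set O : set G | open O /\ E `<=` O]]
    & forall O : set G, open O ->
        mu O = ereal_sup [set mu K | K in [set K : set G | compact K /\ K `<=` O]]].

Definition left_haar mu : Prop :=
  [/\ radon mu, mu [set: G] != 0
    & forall (g : G) (E : set (borel G)), measurable E ->
        mu [set (g * x)%g | x in (E : set G)] = mu E].

Definition right_haar mu : Prop :=
  [/\ radon mu, mu [set: G] != 0
    & forall (g : G) (E : set (borel G)), measurable E ->
        mu [set (x * g)%g | x in (E : set G)] = mu E].

Definition is_modulus lambda (phi : topAut G) (Delta : R) : Prop :=
  (0 < Delta)%R /\
  forall E : set (borel G), measurable E -> lambda (phi @` E) = Delta%:E * lambda E.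

Fixpoint trajectory (phi : G -> G) (U : set G) (n : nat) : set G :=
  if n is m.+1 then mulset (trajectory phi U m) (iter m phi @` U)
  else [set 1%g].

(* The value at n = 0 does not affect the upper limit. *)
Definition H_alg mu (phi : G -> G) (U : set G) : \bar R :=
  limn_esup (fun n => lne (mu (trajectory phi U n)) * (n%:R^-1)%:E).

Definition h_alg mu (phi : G -> G) : \bar R :=
  ereal_sup [set H_alg mu phi U | U in [set U | compact U /\ nbhs (1%g : G) U]].

End Haar.

(* Main.v *)
Require Import Defs.
From HB Require Import structures.
From mathcomp Require Import all_boot all_order all_algebra finmap.
From mathcomp Require Import all_classical all_reals all_analysis.

(** For the first part, let [T_n(phi)] be the [n]-th trajectory of [U] under
    [phi].  A compact set times a compact set is closed, so topological
    quasinormality makes [U] permute with every compact subgroup.  As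
    [T_(n+1)(phi) = U phi(T_n(phi))] (lemma [trajectorySl]), every trajectory
    is then a compact subgroup, open for [n > 0], and [phi^(n-1)] carries
    [T_n(phi^-1)] onto [T_n(phi)] ([iter_trajectory_inv]).  Hence the left Haar
    measures of these two subgroups differ by the factor [Delta^(n-1)].  Both
    contain [U], and on compact open subgroups containing [U] every Haar
    measure, left or right, is the index of [U] times the measure of [U]
    ([haar_index]); so their right Haar measures differ by the same factor:
      [log mu(T_n(phi)) = log mu(T_n(phi^-1)) + (n-1) log Delta].
    Dividing by [n] and taking upper limits gives the formula ([H_alg_inv]).

    For the second part, [H_alg] is monotone in the neighborhood, so it is
    enough to enclose each compact neighborhood of the identity in a compact
    open subgroup ([compact_open_subgroup_above]), where the first part
    applies.  Two facts make this possible.  In a quasihamiltonian group the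
    product of two compact subgroups is a compact subgroup, hence finite sets
    lie in compact subgroups.  And if [V] is a symmetric compact neighborhood
    of the identity, finitely many elements control the growth of all the
    powers of [V] at once. *)

Set Implicit Arguments.
Unset Strict Implicit.
Unset Printing Implicit Defensive.
Import Order.TTheory GRing.Theory Num.Theory.
Import numFieldNormedType.Exports.

Local Open Scope classical_set_scope.

(** * Products of subsets and compact subgroups *)

Section SubsetProducts.
Local Open Scope group_scope.
Variable G : topologicalGroupType.
Implicit Types A B C H K L U V : set G.

Definition setinv A : set G := [set x^-1 | x in A].

Definition rcoset U (t : G) : set G := [set x * t | x in U].

Lemma mulset_mem A B x y : A x -> B y -> mulset A B (x * y).
Proof. by move=> Ax By; exists x => //; exists y. Qed.

Lemma mulsetS A A' B B' :
  A `<=` A' -> B `<=` B' -> mulset A B `<=` mulset A' B'.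
Proof.
move=> sA sB _ [x Ax [y By <-]].
by apply: mulset_mem; [exact: sA|exact: sB].
Qed.

Lemma mulsetA A B C : mulset A (mulset B C) = mulset (mulset A B) C.
Proof.
apply/seteqP; split => [_ [x Ax [_ [y By [z Cz <-]] <-]]|].
  by rewrite mulgA; apply: mulset_mem => //; exact: mulset_mem.
move=> _ [_ [x Ax [y By <-]] [z Cz <-]].
by rewrite -mulgA; apply: mulset_mem => //; exact: mulset_mem.
Qed.

Lemma mulset1l A : mulset [set 1] A = A.
Proof.
apply/seteqP; split => [_ [_ -> [y Ay <-]]|x Ax]; first by rewrite mul1g.
by rewrite -[x]mul1g; exact: mulset_mem.
Qed.

Lemma mulset1r A : mulset A [set 1] = A.
Proof.
apply/seteqP; split => [_ [x Ax [_ -> <-]]|x Ax]; first by rewrite mulg1.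
by rewrite -[x]mulg1; exact: mulset_mem.
Qed.

Lemma image_mulset (f : G -> G) A B : {morph f : x y / x * y} ->
  f @` mulset A B = mulset (f @` A) (f @` B).
Proof.
move=> fM; apply/seteqP; split => [_ [_ [x Ax [y By <-]] <-]|].
  by rewrite fM; apply: mulset_mem; [exists x|exists y].
move=> _ [_ [x Ax <-] [_ [y By <-] <-]].
by rewrite -fM; exists (x * y) => //; exact: mulset_mem.
Qed.

Lemma setinv_rcoset H t : subgroup H ->
  setinv (rcoset H t) = [set t^-1 * x | x in H].
Proof.
move=> [_ _ HV]; apply/seteqP; split => [_ [_ [x Hx <-] <-]|_ [x Hx <-]].
  by rewrite invgM; exists x^-1 => //; exact: HV.
by exists (x^-1 * t); [exists x^-1 => //; exact: HV|rewrite invgM invgK].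
Qed.

Lemma subgroup1 : subgroup [set 1 : G].
Proof. by split=> // [x y -> ->|x ->]; rewrite ?mulg1 ?invg1. Qed.

Lemma mulset_subgroup H K :
  subgroup H -> subgroup K -> mulset H K = mulset K H -> subgroup (mulset H K).
Proof.
move=> [H1 HM HV] [K1 KM KV] HK; split.
- by rewrite -[1]mulg1; exact: mulset_mem.
- move=> _ _ [h Hh [k Kk <-]] [h' Hh' [k' Kk' <-]].
  have [h'' Hh'' [k'' Kk'' e]] : mulset H K (k * h').
    by rewrite HK; exact: mulset_mem.
  rewrite -mulgA [k * _]mulgA -e -!mulgA mulgA.
  by apply: mulset_mem; [exact: HM|exact: KM].
- move=> _ [h Hh [k Kk <-]]; rewrite invgM HK.
  by apply: mulset_mem; [exact: KV|exact: HV].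
Qed.

Lemma rcoset_open U t : open U -> open (rcoset U t).
Proof.
move=> oU; have -> : rcoset U t = (fun x => x * t^-1) @^-1` U.
  apply/seteqP; split=> [_ [x Ux <-]|x Ux] /=; first by rewrite mulgK.
  by exists (x * t^-1) => //; rewrite mulgVK.
move: U oU; apply/continuousP => x.
apply: (@continuous_comp _ _ _ (fun y : G => (y, t^-1)) (fun p => p.1 * p.2)).
  by apply: cvg_pair; [exact: cvg_id|exact: cvg_cst].
exact: mulg_continuous.
Qed.

Lemma lcoset_open U t : open U -> open [set t * x | x in U].
Proof.
move=> oU; have -> : [set t * x | x in U] = (fun x => t^-1 * x) @^-1` U.
  apply/seteqP; split=> [_ [x Ux <-]|x Ux] /=; first by rewrite mulKg.
  by exists (t^-1 * x) => //; rewrite mulVKg.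
move: U oU; apply/continuousP => x.
apply: (@continuous_comp _ _ _ (fun y : G => (t^-1, y)) (fun p => p.1 * p.2)).
  by apply: cvg_pair; [exact: cvg_cst|exact: cvg_id].
exact: mulg_continuous.
Qed.

Lemma mulset_compact A B : compact A -> compact B -> compact (mulset A B).
Proof.
move=> cA cB; rewrite /mulset image2E.
have -> : uncurry (fun x y : G => x * y) = fun p => p.1 * p.2.
  by apply/funext => -[].
apply: continuous_compact; last exact: compact_setX.
exact/continuous_subspaceT/mulg_continuous.
Qed.

Lemma setinv_compact A : compact A -> compact (setinv A).
Proof.
move=> cA; apply: continuous_compact => //.
exact/continuous_subspaceT/invg_continuous.
Qed.

Lemma subgroup_nbhs_open H : subgroup H -> nbhs (1 : G) H -> open H.
Proof.
move=> [_ HM _] /nbhs_interior nH.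
have -> : H = \bigcup_(t in H) rcoset (interior H) t.
  apply/seteqP; split=> [x Hx|_ [t Ht [x Hx <-]]]; last first.
    by apply: HM => //; exact: interior_subset.
  exists x => //; exists 1; last by rewrite mul1g.
  exact: nbhs_singleton.
by apply: bigcup_open => t _; apply: rcoset_open; exact: open_interior.
Qed.

(** A point adherent to an open subgroup [H] has its own coset of [H] as a
    neighborhood, and this coset can only meet [H] by being equal to it. *)
Lemma open_subgroup_closed H : subgroup H -> open H -> closed H.
Proof.
move=> [H1 HM HV] oH x clHx.
have [|y [Hy [z Hz zxy]]] := clHx (rcoset H x).
  by apply: open_nbhs_nbhs; split; [exact: rcoset_open|exists 1; rewrite ?mul1g].
have -> : x = z^-1 * y by rewrite -zxy mulKg.
by apply: HM => //; exact: HV.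
Qed.

(** Products of compact sets are closed, so the closures in the definition of
    topological quasinormality disappear. *)
Lemma quasinormal_compact_comm N L :
  hausdorff_space G -> topologically_quasinormal N -> compact N ->
  subgroup L -> compact L -> mulset N L = mulset L N.
Proof.
move=> hG qN cN sL cL; have cl := compact_closed hG.
have := qN L (conj sL (cl _ cL)).
by rewrite -!(closure_id _).1//; apply: cl; exact: mulset_compact.
Qed.

(** In a quasihamiltonian group the product of two compact subgroups is
    again a compact subgroup, so finite sets inherit from points the property
    of lying in a compact subgroup. *)
Lemma finite_in_compact_subgroup (s : seq G) :
  hausdorff_space G -> compactly_covered G ->
  topologically_quasihamiltonian G ->
  exists C : set G, [/\ subgroup C, compact C & forall x, x \in s -> C x].
Proof.
move=> hG ccG qG; elim: s => [|a s [C [sC cC Cs]]].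
  by exists [set 1]; split; [exact: subgroup1|exact: compact_set1|].
have [K [sK cK Ka]] := ccG a; have [K1 _ _] := sK; have [C1 _ _] := sC.
have qK := qG K (conj sK (compact_closed hG cK)).
exists (mulset K C); split.
- by apply: mulset_subgroup => //; exact: quasinormal_compact_comm.
- exact: mulset_compact.
- move=> x; rewrite inE => /orP[/eqP ->|/Cs Cx].
    by rewrite -[a]mulg1; exact: mulset_mem.
  by rewrite -[x]mul1g; exact: mulset_mem.
Qed.

Lemma compact_rcoset_cover K U : compact K -> open U -> U 1 ->
  exists2 s : seq G, (forall x, x \in s -> K x) &
    forall x, K x -> exists2 t, t \in s & rcoset U t x.
Proof.
rewrite compact_cover => cK oU U1.
have [|x Kx|D DK KD] := cK G K (rcoset U).
- by move=> t _; exact: rcoset_open.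
- by exists x => //; exists 1; rewrite ?mul1g.
- exists (enum_fset D); first by move=> x /DK; rewrite inE.
  by move=> x /KD[t /= tD Utx]; exists t.
Qed.

Fixpoint mulset_pow V n : set G :=
  if n is m.+1 then mulset V (mulset_pow V m) else [set 1].

Lemma mulset_powD V m n x y :
  mulset_pow V m x -> mulset_pow V n y -> mulset_pow V (m + n) (x * y).
Proof.
elim: m x => [x -> |m IHm x /= [v Vv [z Vz <-]]] Vy; first by rewrite mul1g.
by rewrite -mulgA; apply: mulset_mem => //; exact: IHm.
Qed.

Lemma mulset_pow_subgroup V : setinv V `<=` V -> subgroup (\bigcup_n mulset_pow V n).
Proof.
move=> VV; split; first by exists 0%N.
- by move=> x y [m _ Vx] [n _ Vy]; exists (m + n)%N => //; exact: mulset_powD.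
- move=> x [n _]; elim: n x => [x -> |n IHn x [v Vv [y Vy <-]]].
    by exists 0%N => //; rewrite invg1.
  have [m _ Vm] := IHn _ Vy; exists (m + 1)%N => //.
  rewrite invgM; apply: mulset_powD => //=; rewrite mulset1r.
  by apply: VV; exists v.
Qed.

(** Let [V] be the symmetrization of [U].  By compactness [VV] lies in [VF]
    for a finite set [F], and [F] lies in a compact subgroup [C].  Hence
    [VV] lies in [VC] and, by induction, so does every power of [V]: the
    subgroup generated by [V] is open, therefore closed, and lies in the
    compact set [VC]. *)
Lemma compact_open_subgroup_above U :
  hausdorff_space G -> compactly_covered G ->
  topologically_quasihamiltonian G -> compact U -> nbhs (1 : G) U ->
  exists H : set G, [/\ subgroup H, compact H, open H & U `<=` H].
Proof.
move=> hG ccG qG cU nU; pose V := U `|` setinv U.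
have cV : compact V by apply: compactU => //; exact: setinv_compact.
have VV : setinv V `<=` V.
  move=> _ [x [Ux|[y Uy <-]] <-]; first by right; exists x.
  by left; rewrite invgK.
have nV : nbhs (1 : G) (interior V).
  by apply: nbhs_interior; apply: filterS nU => x; left.
have [s _ sV] := compact_rcoset_cover (mulset_compact cV cV)
  (@open_interior _ V) (nbhs_singleton nV).
have [C [sC cC Cs]] := finite_in_compact_subgroup s hG ccG qG.
have [C1 CM _] := sC.
have V1 : V 1 := interior_subset (nbhs_singleton nV).
pose H := \bigcup_n mulset_pow V n.
have sH : subgroup H by exact: mulset_pow_subgroup.
have UH : V `<=` H by move=> x Vx; exists 1%N => //=; rewrite mulset1r.
have oH : open H.
  apply: subgroup_nbhs_open => //; apply: filterS nV.
  exact: subset_trans (@interior_subset _ V) UH.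
have HVC : H `<=` mulset V C.
  move=> x [n _]; elim: n x => [_ ->|n IHn _ [v Vv [y Vy <-]]].
    by rewrite -[1]mulg1; exact: mulset_mem.
  have [w Vw [c Cc <-]] := IHn _ Vy.
  have [t ts [w' Vw' e]] := sV _ (mulset_mem Vv Vw).
  rewrite mulgA -e -mulgA; apply: mulset_mem; first exact: interior_subset.
  by apply: CM => //; exact: Cs.
exists H; split => //.
- apply: subclosed_compact HVC; first exact: open_subgroup_closed.
  exact: mulset_compact.
- by move=> x Ux; apply: UH; left.
Qed.

End SubsetProducts.

(** * Trajectories of automorphisms *)

Section Trajectories.
Local Open Scope group_scope.
Variable G : topologicalGroupType.
Implicit Types U V : set G.

Lemma topaut1 (phi : topAut G) : phi 1 = 1.
Proof. by apply: (mulgI (phi 1)); rewrite -topautM !mulg1. Qed.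

Lemma topautV (phi : topAut G) x : phi x^-1 = (phi x)^-1.
Proof. by apply: (mulgI (phi x)); rewrite -topautM !mulgV topaut1. Qed.

Lemma topaut_subgroup (phi : topAut G) U : subgroup U -> subgroup (phi @` U).
Proof.
move=> [U1 UM UV]; split.
- by exists 1 => //; rewrite topaut1.
- by move=> _ _ [x Ux <-] [y Uy <-]; exists (x * y);
    [exact: UM|rewrite topautM].
- by move=> _ [x Ux <-]; exists x^-1; [exact: UV|rewrite topautV].
Qed.

Lemma topaut_compact (phi : topAut G) U : compact U -> compact (phi @` U).
Proof.
by apply: continuous_compact; exact/continuous_subspaceT/topaut_continuous.
Qed.

Lemma iter_topaut_compact (phi : topAut G) U m :
  compact U -> compact (iter m phi @` U).
Proof.
move=> cU; elim: m => [|m IHm]; first by rewrite image_id.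
rewrite [X in compact X](_ : _ = phi @` (iter m phi @` U)).
  exact: topaut_compact.
by rewrite image_comp.
Qed.

Lemma trajectory_compact (phi : topAut G) U n :
  compact U -> compact (trajectory phi U n).
Proof.
move=> cU; elim: n => [|n IHn] /=; first exact: compact_set1.
by apply: mulset_compact => //; exact: iter_topaut_compact.
Qed.

Lemma trajectoryS (phi : G -> G) U V n :
  U `<=` V -> trajectory phi U n `<=` trajectory phi V n.
Proof.
move=> UV; elim: n => //= n IHn.
by apply: mulsetS => //; exact: image_subset.
Qed.

(** The defining recursion adds a factor on the right, with a new iterate of
    [phi]; adding it on the left instead involves only [U] and [phi], so that
    hypotheses on [U] alone support an induction. *)
Lemma trajectorySl (phi : topAut G) U n :
  trajectory phi U n.+1 = mulset U (phi @` trajectory phi U n).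
Proof.
elim: n => [|n IHn].
  by rewrite /= image_id image_set1 topaut1 mulset1l mulset1r.
transitivity (mulset (trajectory phi U n.+1) (iter n.+1 phi @` U)) => //.
rewrite [in LHS]IHn -mulsetA; congr (mulset U _).
rewrite [in RHS]/= image_mulset; last exact: topautM.
by congr mulset; rewrite image_comp.
Qed.

Lemma trajectory_sub (phi : topAut G) U n :
  subgroup U -> U `<=` trajectory phi U n.+1.
Proof.
move=> [U1 _ _] x Ux; elim: n => [|n IHn].
  by rewrite /= image_id mulset1l.
rewrite -[x]mulg1; apply: mulset_mem => //=.
by exists 1 => //; rewrite -iterS; elim: n.+1 => //= m ->; exact: topaut1.
Qed.

Section Quasinormal.
Variables (phi : topAut G) (U : set G).
Hypotheses (hG : hausdorff_space G) (sU : subgroup U) (cU : compact U).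
Hypothesis qU : topologically_quasinormal U.

Lemma trajectory_subgroup n : subgroup (trajectory phi U n).
Proof.
elim: n => [|n IHn]; first exact: subgroup1.
rewrite trajectorySl; apply: mulset_subgroup => //; first exact: topaut_subgroup.
apply: quasinormal_compact_comm => //; first exact: topaut_subgroup.
by apply: topaut_compact; exact: trajectory_compact.
Qed.

(** Applying [phi] [n] times to [U (phi^-1 U) ... (phi^-n U)] gives
    [(phi^n U) ... (phi U) U], the factors of a trajectory of [phi] in reverse
    order; since [U] permutes with every compact subgroup, the order does not
    matter. *)
Lemma iter_trajectory_inv n :
  iter n phi @` trajectory (topaut_inv phi) U n.+1 = trajectory phi U n.+1.
Proof.
have iterM (f : topAut G) m : {morph iter m f : x y / x * y}.
  by elim: m => // m IHm x y /=; rewrite IHm topautM.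
have iterK m : cancel (iter m (topaut_inv phi)) (iter m phi).
  elim: m => // m IHm x.
  by rewrite iterSr /= (topautVK phi) IHm.
elim: n => [|n IHn]; first by rewrite image_id.
rewrite (trajectorySl phi) quasinormal_compact_comm //; first last.
- by apply: topaut_compact; exact: trajectory_compact.
- by apply: topaut_subgroup; exact: trajectory_subgroup.
rewrite -IHn [trajectory _ U n.+2]/= -/(trajectory (topaut_inv phi) U n.+1).
rewrite image_mulset; last exact: iterM.
congr mulset; first by rewrite image_comp.
rewrite image_comp -[RHS]image_id; apply: eq_imagel => x _ /=.
by rewrite -!iterS; exact: iterK.
Qed.

End Quasinormal.
End Trajectories.

(** * Haar measures of compact open subgroups *)

Section HaarMeasures.
Local Open Scope ring_scope.
Local Open Scope ereal_scope.
Variables (R : realType) (G : topologicalGroupType).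
Implicit Types (mu lambda : {measure set (borel G) -> \bar R}) (U T : set G).

Lemma open_measurable_borel U : open U -> measurable (U : set (borel G)).
Proof. exact: sub_sigma_algebra. Qed.

Lemma compact_measurable_borel U :
  hausdorff_space G -> compact U -> measurable (U : set (borel G)).
Proof.
move=> hG cU; rewrite -[U]setCK; apply: measurableC.
apply: open_measurable_borel; apply: closed_openC.
exact: compact_closed.
Qed.

Lemma finite_rcosets U T : compact T -> subgroup U -> open U ->
  finite_set (rcoset U @` T).
Proof.
move=> cT [U1 UM UV] oU.
have [s _ sT] := compact_rcoset_cover cT oU U1.
apply: (@sub_finite_set _ _ (rcoset U @` [set` s])); last first.
  exact/finite_image/finite_seq.
move=> _ [t /sT[t' /= ts [u Uu <-]] <-]; exists t' => //.
apply/seteqP; split=> _ [x Ux <-].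
  exists (x * u^-1)%g; last by rewrite mulgA mulgVK.
  by apply: UM => //; exact: UV.
by exists (x * u)%g; [exact: UM|rewrite mulgA].
Qed.

(** The classes are reindexed by [f] so that a single set [Q] of right cosets
    can count both the right cosets ([f] the identity) and the left cosets
    ([f] the inversion). *)
Lemma measure_finite_partition mu (T : set G) (Q : set (set G))
    (f : set G -> set G) c :
  finite_set Q -> trivIset Q f -> (forall A, Q A -> open (f A)) ->
  T = \bigcup_(A in Q) f A -> (forall A, Q A -> mu (f A) = c) ->
  mu T = (#|` fset_set Q|)%:R%:E * c.
Proof.
move=> fQ tQ oQ -> mQ; rewrite (measure_fin_bigcup mu fQ tQ); last first.
  by move=> A QA; apply: open_measurable_borel; exact: oQ.
rewrite (eq_fsbigr (fun=> c)); last by move=> A /set_mem; exact: mQ.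
rewrite fsbig_finite// big_const_seq count_predT.
elim: (size _) => [|n IHn] /=; first by rewrite mul0e.
by rewrite IHn -nat1r EFinD ge0_muleDl// mul1e.
Qed.

(** Both measures of [T] are the index of [U] in [T] times the measure of
    [U]: the right cosets of [U] are translates for [mu], and their inverses,
    the left cosets, are translates for [lambda]. *)
Lemma haar_index mu lambda U T : right_haar mu -> left_haar lambda ->
  subgroup U -> open U -> subgroup T -> compact T -> U `<=` T ->
  exists k : nat, mu T = k%:R%:E * mu U /\ lambda T = k%:R%:E * lambda U.
Proof.
move=> [_ _ muR] [_ _ lambdaL] sU oU [T1 TM TV] cT UT.
have [U1 UM UV] := sU.
pose Q := rcoset U @` T.
have fQ : finite_set Q by exact: finite_rcosets.
have disjQ (A B : set G) x : Q A -> Q B -> A x -> B x -> A = B.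
  suff sub C D : Q C -> Q D -> C x -> D x -> C `<=` D.
    by move=> QA QB Ax Bx; apply/seteqP; split; exact: sub.
  move=> [s _ <-] [t _ <-] [u Uu us] [v Vv vt] _ [w Uw <-].
  exists (w * u^-1 * v)%g; first exact: (UM _ _ (UM _ _ Uw (UV _ Uu)) Vv).
  by rewrite -mulgA vt -us -mulgA mulKg.
have mU := open_measurable_borel oU.
exists #|` fset_set Q|; split.
- apply: (@measure_finite_partition _ _ _ id) => //.
  + by move=> A B QA QB [x [Ax Bx]]; exact: disjQ Ax Bx.
  + by move=> _ [t _ <-]; exact: rcoset_open.
  + apply/seteqP; split=> [t Tt|_ [_ [t Tt <-] [u Uu <-]]].
      by exists (rcoset U t); [exists t|exists 1%g; rewrite ?mul1g].
    by apply: TM => //; exact: UT.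
  + by move=> _ [t _ <-]; exact: muR.
- apply: (@measure_finite_partition _ _ _ (@setinv G)) => //.
  + move=> A B QA QB [_ [[x Ax <-] [y By]]] /invg_inj yx.
    by apply: (disjQ A B x) => //; rewrite -yx.
  + by move=> _ [t _ <-]; rewrite setinv_rcoset//; exact: lcoset_open.
  + apply/seteqP; split=> [t Tt|_ [_ [t Tt <-] [_ [u Uu <-] <-]]].
      exists (rcoset U t^-1%g); first by exists t^-1%g => //; exact: TV.
      exists t^-1%g; last by rewrite invgK.
      by exists 1%g; rewrite ?mul1g.
    by apply: TV; apply: TM => //; exact: UT.
  + by move=> _ [t _ <-]; rewrite setinv_rcoset//; exact: lambdaL.
Qed.

(** If [U] were null, so would be every compact set, being covered by
    finitely many of the sets [tr t], and then the whole group by inner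
    regularity.  Left or right translation of [U] provides [tr]. *)
Lemma radon_open_gt0 mu U (tr : G -> set G) :
  hausdorff_space G -> radon mu -> mu [set: G] != 0 ->
  (forall t, [/\ open (tr t), tr t t & mu (tr t) = mu U]) -> 0 < mu U.
Proof.
move=> hG [_ _ muI] mu0 trP; rewrite lt0e measure_ge0 andbT.
apply: contra mu0 => /eqP muU0.
have -> : mu [set: G] = ereal_sup [set mu K | K in
    [set K : set G | compact K /\ K `<=` [set: G]]].
  by apply: muI; exact: openT.
rewrite eq_le; apply/andP; split; last first.
  by apply: ereal_sup_ubound; exists set0; rewrite ?measure0//; split=> //;
    exact: compact0.
apply: ge_ereal_sup => _ [K [cK _] <-].
have := cK; rewrite compact_cover => /(_ G setT tr) [t _|x _|D _ DK].
- by have [] := trP t.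
- by exists x => //; have [] := trP x.
apply: (@le_trans _ _ (\sum_(t \in [set` D]) mu (tr t))).
  apply: content_sub_fsum => //.
  - by move=> t _; apply: open_measurable_borel; have [] := trP t.
  - exact: compact_measurable_borel.
rewrite (eq_fsbigr (fun=> 0)); last by move=> t _; have [_ _ ->] := trP t.
by rewrite fsbig1.
Qed.

Lemma haar_open_subgroup_gt0 mu U : hausdorff_space G ->
  right_haar mu \/ left_haar mu -> subgroup U -> open U ->
  0 < mu U.
Proof.
move=> hG [] [radon_mu mu0 mu_inv] [U1 _ _] oU.
- apply: (radon_open_gt0 hG radon_mu mu0 (tr := rcoset U)) => t; split.
  + exact: rcoset_open.
  + by exists 1%g; rewrite ?mul1g.
  + by apply: mu_inv; exact: open_measurable_borel.
- apply: (radon_open_gt0 hG radon_mu mu0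
    (tr := fun t => [set (t * x)%g | x in U])) => t; split.
  + exact: lcoset_open.
  + by exists 1%g; rewrite ?mulg1.
  + by apply: mu_inv; exact: open_measurable_borel.
Qed.

(** A comparison made with the left Haar measure transfers to the right one,
    because on both sides it is a comparison of the indices of [U]. *)
Lemma haar_ratio mu lambda U T T' (c : R) : hausdorff_space G ->
  right_haar mu -> left_haar lambda -> subgroup U -> open U ->
  subgroup T -> compact T -> U `<=` T ->
  subgroup T' -> compact T' -> U `<=` T' ->
  lambda T = c%:E * lambda T' -> mu T = c%:E * mu T'.
Proof.
move=> hG hmu hla sU oU sT cT UT sT' cT' UT'.
have [k [-> ->]] := haar_index hmu hla sU oU sT cT UT.
have [k' [-> ->]] := haar_index hmu hla sU oU sT' cT' UT'.
have laU0 : 0 < lambda U by apply: haar_open_subgroup_gt0 => //; right.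
have laUoo : lambda U < +oo.
  have [[lafin _ _] _ _] := hla.
  apply: le_lt_trans (lafin T cT).
  apply: le_measure => //; rewrite inE; first exact: open_measurable_borel.
  exact: compact_measurable_borel.
have : lambda U \is a fin_num by rewrite ge0_fin_numE// ltW.
case: (lambda U) laU0 laUoo => // l l0 _ _.
rewrite !muleA -!EFinM => -[] /mulIf ->//.
by move: l0; rewrite lte_fin; exact: lt0r_neq0.
Qed.

Lemma modulus_iter lambda (phi : topAut G) Delta (K : set G) m :
  hausdorff_space G -> is_modulus lambda phi Delta -> compact K ->
  lambda (iter m phi @` K) = (Delta ^+ m)%:E * lambda K.
Proof.
move=> hG [_ modP] cK; elim: m => [|m IHm]; first by rewrite image_id expr0 mul1e.
rewrite exprS EFinM -muleA -IHm -modP; first by rewrite image_comp.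
by apply: compact_measurable_borel => //; exact: iter_topaut_compact.
Qed.

End HaarMeasures.

(** * Upper limits *)

Section UpperLimits.
Local Open Scope ring_scope.
Local Open Scope ereal_scope.
Variable R : realType.

(** With [c] null this is monotonicity; used for [c] and [- c] it moves a
    convergent summand out of an upper limit, at infinite values as well. *)
Lemma limn_esup_le_shift (u v : (\bar R)^nat) (c : R^nat) (l : R) :
  (c @ \oo --> l)%classic ->
  (\forall n \near \oo, u n <= v n + (c n)%:E)%classic ->
  limn_esup u <= limn_esup v + l%:E.
Proof.
move=> cl uv; apply/lee_addgt0Pr => e e0.
rewrite -addeA -EFinD -leeBlDr//.
apply: le_ereal_inf_tmp => _ [A nA <-].
rewrite leeBlDr//.
pose B := [set n | u n <= v n + (c n)%:E /\ (c n <= l + e)%R].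
have nB : \oo B.
  near=> n; split; first by near: n.
  by apply: ltW; near: n; apply: (cvgr_lt l) => //; rewrite ltrDl.
apply: (@le_trans _ _ (ereal_sup (u @` (A `&` B)))).
  by apply: ereal_inf_lbound; exists (A `&` B) => //; exact: filterI.
apply: ge_ereal_sup => _ [n [An [un cn]] <-].
apply: (le_trans un); apply: leeD; last by rewrite lee_fin.
by apply: ereal_sup_ubound; exists n.
Unshelve. all: by end_near. Qed.

End UpperLimits.

(** * Algebraic entropy *)

Section Entropy.
Local Open Scope ring_scope.
Local Open Scope ereal_scope.
Variables (R : realType) (G : topologicalGroupType).
Implicit Types (mu lambda : {measure set (borel G) -> \bar R}) (U V : set G).

Lemma cvg_pred_ratio (a : R) :
  (fun n : nat => a * (n.-1%:R / n%:R))%R @ \oo --> a.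
Proof.
rewrite -cvg_shiftS/=.
have -> : (fun n => a * (n%:R / n.+1%:R))%R = (fun n => a * (1 - harmonic n))%R.
  apply/funext => n; congr (a * _)%R.
  by rewrite /harmonic/= -[in LHS](addrK 1%R n%:R)%R natr1 mulrBl divff// div1r.
suff : (fun n => a * (1 - harmonic n))%R @ \oo --> (a * (1 - 0))%R.
  by rewrite subr0 mulr1.
apply: cvgM; first exact: cvg_cst.
by apply: cvgB; [exact: cvg_cst|exact: cvg_harmonic].
Qed.

Lemma le_lne (x y : \bar R) : 0 <= x -> x <= y -> lne x <= lne y.
Proof.
move=> x0 xy; rewrite lee_lne// in_itv/= leey andbT//.
exact: le_trans xy.
Qed.

Lemma H_algS mu (phi : topAut G) U V : hausdorff_space G ->
  compact U -> compact V -> U `<=` V -> H_alg mu phi U <= H_alg mu phi V.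
Proof.
move=> hG cU cV UV; rewrite -[leRHS]adde0.
apply: (limn_esup_le_shift (c := fun=> 0%R)); first exact: cvg_cst.
apply: nearW => n; rewrite adde0 lee_wpmul2r ?lee_fin ?invr_ge0//.
apply: le_lne => //; apply: le_measure; rewrite ?inE.
- by apply: compact_measurable_borel => //; exact: trajectory_compact.
- by apply: compact_measurable_borel => //; exact: trajectory_compact.
- exact: trajectoryS.
Qed.

Section ModulusFormula.
Variables (mu lambda : {measure set (borel G) -> \bar R}).
Variables (phi : topAut G) (Delta : R).
Hypotheses (hG : hausdorff_space G) (hmu : right_haar mu).
Hypotheses (hlambda : left_haar lambda) (hDelta : is_modulus lambda phi Delta).

Section Quasinormal.
Variable U : set G.
Hypotheses (sU : subgroup U) (cU : compact U) (oU : open U).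
Hypothesis qU : topologically_quasinormal U.

Lemma mu_trajectory_inv n : mu (trajectory phi U n.+1) =
  (Delta ^+ n)%:E * mu (trajectory (topaut_inv phi) U n.+1).
Proof.
apply: (haar_ratio hG hmu hlambda sU oU).
- exact: trajectory_subgroup.
- exact: trajectory_compact.
- exact: trajectory_sub.
- exact: trajectory_subgroup.
- exact: trajectory_compact.
- exact: trajectory_sub.
- rewrite -iter_trajectory_inv//; apply: (modulus_iter _ hG hDelta).
  exact: trajectory_compact.
Qed.

(** The trajectories have positive finite measure, so that the logarithm of
    the product really splits. *)
Lemma lne_mu_trajectory_inv n : lne (mu (trajectory phi U n.+1)) =
  lne (mu (trajectory (topaut_inv phi) U n.+1)) + (n%:R * ln Delta)%:E.
Proof.
rewrite mu_trajectory_inv; have [Delta0 _] := hDelta.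
have cT : compact (trajectory (topaut_inv phi) U n.+1).
  exact: trajectory_compact.
have : 0 < mu (trajectory (topaut_inv phi) U n.+1).
  apply: (@lt_le_trans _ _ (mu U)).
    by apply: haar_open_subgroup_gt0 => //; left.
  apply: le_measure; rewrite ?inE; first exact: open_measurable_borel.
  - exact: compact_measurable_borel.
  - exact: trajectory_sub.
have : mu (trajectory (topaut_inv phi) U n.+1) < +oo.
  by have [[mufin _ _] _ _] := hmu; exact: mufin.
case: (mu _) => // r _; rewrite lte_fin => r0.
rewrite -EFinM !lne_EFin//; last by rewrite mulr_gt0// exprn_gt0.
by rewrite lnM ?posrE ?exprn_gt0// lnXn// mulr_natl -EFinD addrC.
Qed.

Lemma H_alg_inv : H_alg mu (topaut_inv phi) U = H_alg mu phi U - (ln Delta)%:E.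
Proof.
pose c (n : nat) := (ln Delta * (n.-1%:R / n%:R))%R.
have trajE n : (0 < n)%N -> lne (mu (trajectory phi U n)) * (n%:R^-1)%:E =
    lne (mu (trajectory (topaut_inv phi) U n)) * (n%:R^-1)%:E + (c n)%:E.
  case: n => // n _; rewrite lne_mu_trajectory_inv muleDl//.
    by rewrite -EFinM /c/= mulrA [(n%:R * _)%R]mulrC.
  by rewrite fin_num_adde_defl.
apply/eqP; rewrite eq_le; apply/andP; split.
- rewrite -EFinN; apply: (limn_esup_le_shift (c := fun n => - c n)%R).
    by apply: cvgN; exact: cvg_pred_ratio.
  by near=> n; rewrite trajE ?EFinN ?addeK//; near: n; exact: nbhs_infty_gt.
- rewrite leeBlDr//; apply: (limn_esup_le_shift (c := c)).
    exact: cvg_pred_ratio.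
  by near=> n; rewrite trajE//; near: n; exact: nbhs_infty_gt.
Unshelve. all: by end_near. Qed.

End Quasinormal.

(** Compact open subgroups being cofinal among the compact neighborhoods of
    the identity, either entropy is bounded by the values at compact open
    subgroups, where the modulus formula is available. *)
Lemma h_alg_inv : compactly_covered G -> topologically_quasihamiltonian G ->
  h_alg mu (topaut_inv phi) = h_alg mu phi - (ln Delta)%:E.
Proof.
move=> ccG qG; have above U : compact U -> nbhs (1%g : G) U ->
    exists H : set G, [/\ compact H, nbhs (1%g : G) H, U `<=` H &
      H_alg mu (topaut_inv phi) H = H_alg mu phi H - (ln Delta)%:E].
  move=> cU nU.
  have [H [sH cH oH UH]] := compact_open_subgroup_above hG ccG qG cU nU.
  exists H; split => //; first exact: filterS nU.
  by apply: H_alg_inv => //; apply: qG; split=> //; exact: compact_closed.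
apply/eqP; rewrite eq_le; apply/andP; split.
- apply: ge_ereal_sup => _ [U [cU /(above _ cU)[H [cH nH UH HE]]] <-].
  apply: (le_trans (H_algS mu (topaut_inv phi) hG cU cH UH)).
  by rewrite HE leeD2r//; apply: ereal_sup_ubound; exists H.
- rewrite leeBlDr//.
  apply: ge_ereal_sup => _ [U [cU /(above _ cU)[H [cH nH UH HE]]] <-].
  apply: (le_trans (H_algS mu phi hG cU cH UH)).
  rewrite -leeBlDr// -HE.
  by apply: ereal_sup_ubound; exists H.
Qed.

End ModulusFormula.
End Entropy.

Local Open Scope classical_set_scope.
Local Open Scope ring_scope.
Local Open Scope ereal_scope.

Theorem proposition4p6 (R : realType) (G : topologicalGroupType)
    (mu lambda : {measure set (borel G) -> \bar R})
    (phi : topAut G) (Delta : R) :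
  hausdorff_space G ->
  locally_compact [set: G] ->
  right_haar mu ->
  left_haar lambda ->
  is_modulus lambda phi Delta ->
  (forall U : set G,
     subgroup U -> compact U -> open U -> topologically_quasinormal U ->
     H_alg mu (topaut_inv phi) U = H_alg mu phi U - (ln Delta)%:E)
  /\
  (compactly_covered G -> topologically_quasihamiltonian G ->
     h_alg mu (topaut_inv phi) = h_alg mu phi - (ln Delta)%:E).
Proof.
move=> hG _ hmu hlambda hDelta; split; last exact: (h_alg_inv hG hmu hlambda hDelta).
by move=> U sU cU oU qU; exact: (H_alg_inv hG hmu hlambda hDelta).
Qed.
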